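(* Let $\mathrm{E}'$ be the ruleset consisting of the structural rules $\mathrm{D10}'$, $\mathrm{D11}$, $\mathrm{D12}$, $\mathrm{D13}$ and $\mathrm{E}$, let $\mathsf{E}'$ be the set of propositional formulas $\varphi$ for which Proponent has an $\mathrm{E}'$-winning strategy, and let $\mathsf{S}$ be stable logic. For every propositional formula $\varphi$, if $\varphi \in \mathsf{E}'$, then $\varphi \in \mathsf{S}$.
   Context: Formulas are built from atoms with $\neg,\vee,\wedge,\rightarrow$. Besides formulas there are three symbolic attacks $?$, $\wedge_L$, $\wedge_R$ (distinct from all formulas). Formulas and symbolic attacks are together called statements. Dialogues. A dialogue for $\varphi$ is a (finite or infinite) sequence of moves numbered $0,1,2,\dots$. Even-numbered moves are made by Proponent ($\mathbf P$), odd-numbered ones by Opponent ($\mathbf O$). Move $0$ is $\mathbf P$'s assertion of $\varphi$. Every later move asserts a statement and is either an attack on a formula asserted by the other player at an earlier move, or a defense against an earlier attack made by the other player, according to the following particle rules. $\alpha\wedge\beta$ is attacked by $\wedge_L$ (defense: assert $\alpha$) or by $\wedge_R$ (defense: assert $\beta$). $\alpha\vee\beta$ is attacked by $?$ (defense: assert $\alpha$ or assert $\beta$, defender's choice). $\alpha\rightarrow\beta$ is attacked by asserting $\alpha$ (defense: assert $\beta$). $\neg\alpha$ is attacked by asserting $\alpha$ (there is no defense). Atoms and symbolic attacks cannot be attacked. Structural rules. ($\mathrm{D10}'$) $\mathbf P$ may assert an atom $p$ (including at move $0$) only if $\mathbf O$ has asserted either $p$ or $\neg\neg p$ before. ($\mathrm{D11}$)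 When defending, a player may respond only to the most recent open attack of the other player, where an attack is open if no defense against it has yet been played (attacks on negations thus remain open forever). ($\mathrm{D12}$) An attack may be answered (defended against) at most once. ($\mathrm{D13}$) A $\mathbf P$-assertion may be attacked at most once. ($\mathrm{E}$) $\mathbf O$ can react only upon the immediately preceding $\mathbf P$-statement (by attacking it or, if it was an attack, by defending against it). Winning. For a ruleset $S$, an $S$-dialogue is a dialogue adhering to all rules of $S$. $\mathbf P$ wins an $S$-dialogue if it is finite, $\mathbf P$ made the last move, and no move is available to $\mathbf O$ by which the dialogue could be extended to an $S$-dialogue. An $S$-winning strategy for $\varphi$ prescribes moves of $\mathbf P$ such that every maximal $S$-dialogue for $\varphi$ in which $\mathbf P$ follows the prescription (with $\mathbf O$ playing arbitrary $S$-permitted moves) is won by $\mathbf P$. Stable logic $\mathsf S$ is the logic axiomatized over propositional intuitionistic logic $\mathsf{IL}$ by the principle $\neg\neg p\rightarrow p$ for atoms $p$ only: it is the least set of formulas containing $\mathsf{IL}$ and $\neg\neg p\rightarrow p$ for every atom $p$ and closed under modus ponens. *)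

(* Defs.v *)
From mathcomp Require Import all_boot.

Set Implicit Arguments.
Unset Strict Implicit.
Unset Printing Implicit Defensive.

(* Negation is primitive; there is no falsum. *)
Inductive formula : Type :=
  | Atom of nat
  | Neg of formula
  | Or of formula & formula
  | And of formula & formula
  | Imp of formula & formula.

Inductive symbolic_attack : Type := Query | AndL | AndR.

Inductive statement : Type :=
  | Form of formula
  | Sym of symbolic_attack.

(* [attack_rule f s]: asserting [s] is an attack on the formula [f]. *)
Inductive attack_rule : formula -> statement -> Prop :=
  | Attack_AndL a b : attack_rule (And a b) (Sym AndL)
  | Attack_AndR a b : attack_rule (And a b) (Sym AndR)
  | Attack_Or a b : attack_rule (Or a b) (Sym Query)
  | Attack_Imp a b : attack_rule (Imp a b) (Form a)
  | Attack_Neg a : attack_rule (Neg a) (Form a).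

(* [defense_rule f s t]: asserting [t] is a defense of the formula [f] against
   the attack [s]. *)
Inductive defense_rule : formula -> statement -> statement -> Prop :=
  | Defense_AndL a b : defense_rule (And a b) (Sym AndL) (Form a)
  | Defense_AndR a b : defense_rule (And a b) (Sym AndR) (Form b)
  | Defense_OrL a b : defense_rule (Or a b) (Sym Query) (Form a)
  | Defense_OrR a b : defense_rule (Or a b) (Sym Query) (Form b)
  | Defense_Imp a b : defense_rule (Imp a b) (Form a) (Form b).

(* The index carried by [Attack] is the number of the move whose assertion is
   attacked; the one carried by [Defense] is the number of the attack that is
   answered. *)
Inductive role : Type :=
  | Opening
  | Attack of nat
  | Defense of nat.

Record move : Type := Move { asserted : statement; role_of : role }.

(* A finite sequence of moves is a [seq move]; its entry [n] is move [n], made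
   by Proponent if [n] is even and by Opponent if [n] is odd. *)
Definition by_P (n : nat) : bool := ~~ odd n.
Definition by_O (n : nat) : bool := odd n.
Definition opponents (i n : nat) : bool := odd i != odd n.

Definition asserts (d : seq move) (n : nat) (s : statement) : Prop :=
  exists r, onth d n = Some (Move s r).

Definition attacks (d : seq move) (n i : nat) : Prop :=
  exists s, onth d n = Some (Move s (Attack i)).

Definition defends (d : seq move) (n j : nat) : Prop :=
  exists s, onth d n = Some (Move s (Defense j)).

Definition opening (phi : formula) : move := Move (Form phi) Opening.

Definition particle_ok (d : seq move) (n : nat) (m : move) : Prop :=
  match role_of m with
  | Opening => False
  | Attack i => i < n /\ opponents i n /\
      exists f, asserts d i (Form f) /\ attack_rule f (asserted m)
  | Defense j => j < n /\ opponents j n /\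
      exists i f s, onth d j = Some (Move s (Attack i)) /\
        asserts d i (Form f) /\ defense_rule f s (asserted m)
  end.

Definition finite_dialogue (phi : formula) (d : seq move) : Prop :=
  onth d 0 = Some (opening phi) /\
  forall n m, 0 < n -> onth d n = Some m -> particle_ok d n m.

(* Rules are conditions on finite sequences of moves; an infinite dialogue
   adheres to a rule when all its initial segments do. *)
Definition ruleset : Type := seq move -> Prop.

Definition D10' : ruleset := fun d =>
  forall n p, by_P n -> asserts d n (Form (Atom p)) ->
    exists k, k < n /\ by_O k /\
      (asserts d k (Form (Atom p)) \/
       asserts d k (Form (Neg (Neg (Atom p))))).

(* Just before move [n], the attack made at move [k] is open. *)
Definition open_attack (d : seq move) (n k : nat) : Prop :=
  k < n /\ (exists i, attacks d k i) /\
  forall l, l < n -> ~ defends d l k.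

Definition D11 : ruleset := fun d =>
  forall n j, defends d n j ->
    open_attack d n j /\
    forall k, opponents k n -> open_attack d n k -> k <= j.

Definition D12 : ruleset := fun d =>
  forall j l l', defends d l j -> defends d l' j -> l = l'.

Definition D13 : ruleset := fun d =>
  forall i n n', by_P i -> attacks d n i -> attacks d n' i -> n = n'.

Definition E : ruleset := fun d =>
  forall n, by_O n -> n < size d -> attacks d n n.-1 \/ defends d n n.-1.

Definition E' : ruleset := fun d => D10' d /\ D11 d /\ D12 d /\ D13 d /\ E d.

Inductive move_sequence : Type :=
  | Finite of seq move
  | Infinite of (nat -> move).

Definition finite_S_dialogue (S : ruleset) (phi : formula) (d : seq move) : Prop :=
  finite_dialogue phi d /\ S d.

Definition S_dialogue (S : ruleset) (phi : formula) (d : move_sequence) : Prop :=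
  match d with
  | Finite s => finite_S_dialogue S phi s
  | Infinite f => forall n, finite_S_dialogue S phi (mkseq f n.+1)
  end.

(* A prescription maps the moves made so far to Proponent's next move. *)
Definition prescription : Type := seq move -> move.

Definition finite_follows (sigma : prescription) (d : seq move) : Prop :=
  forall n m, 0 < n -> by_P n -> onth d n = Some m -> m = sigma (take n d).

Definition follows (sigma : prescription) (d : move_sequence) : Prop :=
  match d with
  | Finite s => finite_follows sigma s
  | Infinite f => forall n, finite_follows sigma (mkseq f n.+1)
  end.

(* Maximality is among the dialogues following [sigma]: a dialogue in which
   [sigma] prescribes a move that is not permitted stops there, with Opponent
   having made the last move. *)
Definition maximal (S : ruleset) (phi : formula) (sigma : prescription)
    (d : move_sequence) : Prop :=
  match d with
  | Finite s => ~ exists m, finite_S_dialogue S phi (rcons s m) /\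
                            finite_follows sigma (rcons s m)
  | Infinite _ => True
  end.

Definition won_by_P (S : ruleset) (phi : formula) (d : move_sequence) : Prop :=
  match d with
  | Finite s => by_P (size s).-1 /\
                ~ exists m, finite_S_dialogue S phi (rcons s m)
  | Infinite _ => False
  end.

(* The first conjunct says that Proponent may make the opening move at all.
   It matters for an atomic [phi]: D10' then forbids the opening move, so there
   are no dialogues and the second conjunct holds vacuously. *)
Definition winning_strategy (S : ruleset) (phi : formula)
    (sigma : prescription) : Prop :=
  finite_S_dialogue S phi [:: opening phi] /\
  forall d, S_dialogue S phi d -> follows sigma d -> maximal S phi sigma d ->
    won_by_P S phi d.

Definition dialogue_logic (S : ruleset) (phi : formula) : Prop :=
  exists sigma, winning_strategy S phi sigma.

(* Kleene's Hilbert-style axiomatization of intuitionistic propositional logic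
   with primitive negation. *)
Inductive IL : formula -> Prop :=
  | IL_K a b : IL (Imp a (Imp b a))
  | IL_S a b c : IL (Imp (Imp a (Imp b c)) (Imp (Imp a b) (Imp a c)))
  | IL_AndI a b : IL (Imp a (Imp b (And a b)))
  | IL_AndEl a b : IL (Imp (And a b) a)
  | IL_AndEr a b : IL (Imp (And a b) b)
  | IL_OrIl a b : IL (Imp a (Or a b))
  | IL_OrIr a b : IL (Imp b (Or a b))
  | IL_OrE a b c : IL (Imp (Imp a c) (Imp (Imp b c) (Imp (Or a b) c)))
  | IL_NegI a b : IL (Imp (Imp a b) (Imp (Imp a (Neg b)) (Neg a)))
  | IL_NegE a b : IL (Imp (Neg a) (Imp a b))
  | IL_MP a b : IL (Imp a b) -> IL a -> IL b.

Inductive stable_logic : formula -> Prop :=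
  | SL_IL a : IL a -> stable_logic a
  | SL_stable p : stable_logic (Imp (Neg (Neg (Atom p))) (Atom p))
  | SL_MP a b :
      stable_logic (Imp a b) -> stable_logic a -> stable_logic b.

(* Main.v *)
Require Import Defs.
From mathcomp Require Import all_boot.
From Stdlib Require Import Classical ClassicalEpsilon.

(** Call a position with Proponent to move sound if
    the formulas asserted so far by Opponent entail, in stable logic, the goal
    of the latest open attack of Opponent, and a position with Opponent to move
    sound if all permitted replies lead to sound positions. If Opponent cannot
    profitably attack an assertion of Proponent, then this assertion is entailed
    by Opponent's assertions: for compound formulas by the introduction rules,
    for atoms by D10' and stability. Hence a sound position after Proponent's
    move comes only from a sound position before it, which is an elimination
    rule if the move is an attack. By contraposition an unsound position can
    always be prolonged, consistently with the strategy, to an unsound position;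
    starting from the opening this would give an infinite dialogue, which
    Proponent does not win. *)

(** * Derivability from hypotheses *)

Inductive entails (G : formula -> Prop) : formula -> Prop :=
  | Ent_hyp a : G a -> entails G a
  | Ent_ax a : stable_logic a -> entails G a
  | Ent_MP a b : entails G (Imp a b) -> entails G a -> entails G b.

Definition add_hyp (G : formula -> Prop) (a : formula) : formula -> Prop :=
  fun b => G b \/ b = a.

Lemma entails_IL G a : IL a -> entails G a.
Proof. by move=> H; apply: Ent_ax; apply: SL_IL. Qed.

Lemma entails_weaken G H a :
  (forall b, G b -> H b) -> entails G a -> entails H a.
Proof.
move=> GH; elim=> {a} [a /GH|a|a b _ IHab _ IHa]; first exact: Ent_hyp.
  exact: Ent_ax.
exact: Ent_MP IHab IHa.
Qed.

Lemma entails_stable_logic G a :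
  (forall b, ~ G b) -> entails G a -> stable_logic a.
Proof.
move=> G0; elim=> {a} [a /G0||a b _ IHab _ IHa] //.
exact: SL_MP IHab IHa.
Qed.

Lemma entails_const G a b : entails G b -> entails G (Imp a b).
Proof. by apply: Ent_MP; apply/entails_IL/IL_K. Qed.

Lemma entails_id G a : entails G (Imp a a).
Proof.
have K := entails_IL G _ (IL_K a (Imp a a)).
apply: Ent_MP (entails_IL _ _ (IL_K a a)).
exact: Ent_MP (entails_IL _ _ (IL_S _ _ _)) K.
Qed.

(** Since modus ponens is the only rule of [entails], the axioms K and S cover every case of the
    induction. *)
Lemma entails_deduction G a b : entails (add_hyp G a) b -> entails G (Imp a b).
Proof.
elim=> {b} [b [Gb|->]|b Sb|b c _ IHbc _ IHb].
- exact/entails_const/Ent_hyp.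
- exact: entails_id.
- exact/entails_const/Ent_ax.
- by apply: Ent_MP IHb; apply: Ent_MP IHbc; apply/entails_IL/IL_S.
Qed.

Lemma entails_cut G a b : entails (add_hyp G a) b -> entails G a -> entails G b.
Proof. by move/entails_deduction; apply: Ent_MP. Qed.

Lemma entails_OrE G a b c : entails G (Or a b) ->
  entails (add_hyp G a) c -> entails (add_hyp G b) c -> entails G c.
Proof.
move=> Hab /entails_deduction Ha /entails_deduction Hb.
apply: Ent_MP Hab; apply: Ent_MP Hb; apply: Ent_MP Ha.
exact/entails_IL/IL_OrE.
Qed.

Lemma entails_explosion G a b : entails G (Neg a) -> entails G a -> entails G b.
Proof. by move=> Hn; apply: Ent_MP; apply: Ent_MP Hn; apply/entails_IL/IL_NegE. Qed.

(** An explicit contradiction serves as the absurd formula; the choice of atom is immaterial. *)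
Definition falsum : formula := And (Atom 0) (Neg (Atom 0)).

Lemma entails_NegI G a : entails (add_hyp G a) falsum -> entails G (Neg a).
Proof.
move=> H.
have H1 : entails G (Imp a (Atom 0)).
  by apply/entails_deduction; apply: Ent_MP H; apply/entails_IL/IL_AndEl.
have H2 : entails G (Imp a (Neg (Atom 0))).
  by apply/entails_deduction; apply: Ent_MP H; apply/entails_IL/IL_AndEr.
by apply: Ent_MP H2; apply: Ent_MP H1; apply/entails_IL/IL_NegI.
Qed.

(** * Extending dialogues by one move *)

Lemma onth_lt {T : Type} {d : seq T} {n x} : onth d n = Some x -> n < size d.
Proof. by rewrite -onthTE => ->. Qed.

Lemma onth_rcons (T : Type) (d : seq T) m n :
  onth (rcons d m) n =
  if n < size d then onth d n else if n == size d then Some m else None.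
Proof.
rewrite -cats1 onth_cat; case: ltnP => // le_dn.
by case: eqVneq => [->|ne]; rewrite ?subnn // onth_default //= subn_gt0 ltn_neqAle eq_sym ne.
Qed.

Lemma onth_rcons_size (T : Type) (d : seq T) m : onth (rcons d m) (size d) = Some m.
Proof. by rewrite onth_rcons ltnn eqxx. Qed.

Lemma onth_rcons_old (T : Type) (d : seq T) m n x :
  onth d n = Some x -> onth (rcons d m) n = Some x.
Proof. by move=> H; rewrite onth_rcons (onth_lt H). Qed.

Lemma onth_rcons_inv {T : Type} {d : seq T} {m n x} :
  onth (rcons d m) n = Some x -> onth d n = Some x \/ n = size d /\ m = x.
Proof.
rewrite onth_rcons; case: ifP => _; first by left.
by case: eqP => // -> [->]; right.
Qed.

Lemma asserts_rcons d m n s : asserts d n s -> asserts (rcons d m) n s.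
Proof. by case=> r H; exists r; apply: onth_rcons_old. Qed.

Lemma particle_ok_rcons d m n x : particle_ok d n x -> particle_ok (rcons d m) n x.
Proof.
rewrite /particle_ok; case: (role_of x) => // i [lt_in [opp]].
  by case=> f [af rf]; do 2!split=> //; exists f; split=> //; apply: asserts_rcons.
case=> k [f [s [Hi [af rf]]]]; do 2!split=> //; exists k, f, s; split.
  exact: onth_rcons_old.
by split=> //; apply: asserts_rcons.
Qed.

Lemma finite_dialogue_particle phi d n s r : finite_dialogue phi d ->
  onth d n = Some (Move s r) -> r <> Opening -> particle_ok d n (Move s r).
Proof.
move=> [d0 dok] Hn rO; apply: (dok) => //; case: n Hn => // Hn.
by case: rO; move: Hn; rewrite d0 => -[_ <-].
Qed.

Lemma attacks_lt phi d n i : finite_dialogue phi d -> attacks d n i ->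
  i < n /\ opponents i n.
Proof. by move=> Hd [s Hs]; have [] // := finite_dialogue_particle _ _ _ _ _ Hd Hs => ? []. Qed.

Lemma defends_lt phi d n j : finite_dialogue phi d -> defends d n j -> j < n.
Proof. by move=> Hd [s Hs]; have [] := finite_dialogue_particle _ _ _ _ _ Hd Hs. Qed.

Lemma attacks_rcons_inv {d m n i} : attacks (rcons d m) n i ->
  attacks d n i \/ n = size d /\ role_of m = Attack i.
Proof.
by case=> s /onth_rcons_inv [H|[-> ->]]; [left; exists s | right].
Qed.

Lemma defends_rcons_inv {d m n j} : defends (rcons d m) n j ->
  defends d n j \/ n = size d /\ role_of m = Defense j.
Proof.
by case=> s /onth_rcons_inv [H|[-> ->]]; [left; exists s | right].
Qed.

(** The added move has number [size d], so it is not among the first [n] moves, which alone decide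
    openness. *)
Lemma open_attack_rcons d m n k :
  n <= size d -> open_attack (rcons d m) n k <-> open_attack d n k.
Proof.
move=> le_nd; split=> -[lt_kn [[i Ha] Hd]]; split=> //; split.
- exists i; case/attacks_rcons_inv: Ha => // -[Ek _].
  by move: (leq_trans lt_kn le_nd); rewrite Ek ltnn.
- by move=> l lt_ln [s Hl]; apply: (Hd l lt_ln); exists s; apply: onth_rcons_old.
- by exists i; case: Ha => s Hs; exists s; apply: onth_rcons_old.
- move=> l lt_ln /defends_rcons_inv [/(Hd l lt_ln) //|[El _]].
  by move: (leq_trans lt_ln le_nd); rewrite El ltnn.
Qed.

(* Rules D10'-D13 never restrict a reaction of Opponent to the immediately
   preceding move: that move cannot have been reacted to before. *)
Lemma opponent_reply_permitted phi d m :
  finite_S_dialogue E' phi d -> odd (size d) ->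
  particle_ok (rcons d m) (size d) m ->
  role_of m = Attack (size d).-1 \/ role_of m = Defense (size d).-1 ->
  finite_S_dialogue E' phi (rcons d m).
Proof.
move=> [Hd [h10 [h11 [h12 [h13 hE]]]]] od mok rm.
have sd : (size d).-1.+1 = size d by case: (size d) od.
have Hd' : finite_dialogue phi (rcons d m).
  case: Hd => d0 dok; split; first exact: onth_rcons_old.
  move=> n x n0 /onth_rcons_inv [/(dok _ _ n0)|[-> <-]] //.
  exact: particle_ok_rcons.
(* A reaction to the last move of [d] would carry a number beyond the end of [d]. *)
have nodef l : defends d l (size d).-1 -> False.
  move=> Hl; have := defends_lt _ _ _ _ Hd Hl; rewrite sd.
  by case: Hl => s /onth_lt; rewrite ltnNge => /negP.
have noatt l : attacks d l (size d).-1 -> False.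
  move=> Hl; have [] := attacks_lt _ _ _ _ Hd Hl; rewrite sd.
  by case: Hl => s /onth_lt; rewrite ltnNge => /negP.
split=> //; split; last split; last split; last split.
- move=> n p Pn [r] /onth_rcons_inv [Hn|[En]]; last by move: Pn; rewrite En /by_P od.
  case: (h10 n p Pn) => [|k [lt_kn [Ok Hk]]]; first by exists r.
  by exists k; do 2!split=> //; case: Hk => Hk; [left|right]; apply: asserts_rcons.
- move=> n j /defends_rcons_inv [Hn|[-> Rm]].
    have le_nd : n <= size d by case: Hn => s /onth_lt /ltnW.
    have [Hj Hk] := h11 _ _ Hn; split; first by apply/open_attack_rcons.
    by move=> k opp /(open_attack_rcons _ _ _ _ le_nd); apply: Hk.
  have Ej : j = (size d).-1 by case: rm; rewrite Rm => // -[].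
  move: mok; rewrite /particle_ok Rm => -[lt_jd [_ [i [f [s [Hj _]]]]]].
  (* The maximality in D11 is automatic: [j] is the last move before the reply. *)
  split=> [|k _ [lt_kd _]]; last by rewrite Ej -ltnS sd.
  split=> //; split; first by exists i, s.
  move=> l lt_ld /defends_rcons_inv [|[El _]]; first by rewrite Ej => /nodef.
  by move: lt_ld; rewrite El ltnn.
- move=> j l l' /defends_rcons_inv [Hl|[-> Rl]] /defends_rcons_inv [Hl'|[-> Rl']] //.
  + exact: h12 Hl Hl'.
  + by case: rm; rewrite Rl' => // -[Ej]; move: Hl; rewrite Ej => /nodef.
  + by case: rm; rewrite Rl => // -[Ej]; move: Hl'; rewrite Ej => /nodef.
- move=> i n n' Pi /attacks_rcons_inv [Hn|[-> Rn]] /attacks_rcons_inv [Hn'|[-> Rn']] //.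
  + exact: h13 Pi Hn Hn'.
  + by case: rm; rewrite Rn' => // -[Ei]; move: Hn; rewrite Ei => /noatt.
  + by case: rm; rewrite Rn => // -[Ei]; move: Hn'; rewrite Ei => /noatt.
- move=> n On; rewrite size_rcons ltnS leq_eqVlt => /orP [/eqP -> | lt_nd].
    have Hm := onth_rcons_size _ d m.
    by case: m Hm rm {mok Hd'} => [s r] Hm /= [Er|Er];
      [left | right]; exists s; rewrite -Er.
  case: (hE n On lt_nd) => -[s Hs]; [left|right]; exists s; exact: onth_rcons_old.
Qed.

(** * Soundness of positions *)

Definition opponent_asserted (d : seq move) (a : formula) : Prop :=
  exists k, by_O k /\ asserts d k (Form a).

(* An attack on a negation, to which there is no defense, has an absurd goal. *)
Definition attack_goal (f : formula) (s : statement) : formula :=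
  match f, s with
  | And a b, Sym AndL => a
  | And a b, Sym AndR => b
  | Or a b, _ => Or a b
  | Imp a b, _ => b
  | _, _ => falsum
  end.

Definition latest_open_attack (d : seq move) (f : formula) (s : statement) : Prop :=
  exists j i, [/\ by_O j, onth d j = Some (Move s (Attack i)),
    asserts d i (Form f), open_attack d (size d) j &
    forall k, by_O k -> open_attack d (size d) k -> k <= j].

Definition sound_for_P (d : seq move) : Prop :=
  forall f s, latest_open_attack d f s ->
    entails (opponent_asserted d) (attack_goal f s).

Definition sound_for_O (phi : formula) (d : seq move) : Prop :=
  forall m, finite_S_dialogue E' phi (rcons d m) -> sound_for_P (rcons d m).

Lemma opponent_asserted_rcons_P d m a : ~~ odd (size d) ->
  opponent_asserted (rcons d m) a -> opponent_asserted d a.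
Proof.
move=> ed [k [Ok [r]]] /onth_rcons_inv [H|[Ek _]]; first by exists k; split=> //; exists r.
by move: Ok; rewrite Ek /by_O (negPf ed).
Qed.

Lemma opponent_asserted_rcons_O {d m a} : opponent_asserted (rcons d m) a ->
  opponent_asserted d a \/ asserted m = Form a.
Proof.
move=> [k [Ok [r]]] /onth_rcons_inv [H|[_ ->]]; last by right.
by left; exists k; split=> //; exists r.
Qed.

(** Only disjunction needs an axiom, the injection of the chosen disjunct; otherwise the defense
    asserts the goal itself. *)
Lemma defense_goal f s t : defense_rule f s t ->
  exists2 c, t = Form c & forall G, entails G c -> entails G (attack_goal f s).
Proof.
case=> a b; [exists a|exists b|exists a|exists b|exists b] => //= G;
  by apply: Ent_MP; apply: entails_IL; constructor.
Qed.

(** * Opponent's replies read as inferences *)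

(** Opponent may always attack the last assertion, and this attack, just made and still unanswered,
    becomes the latest open one. *)
Lemma reply_attack_sound phi d t s :
  finite_S_dialogue E' phi d -> odd (size d) ->
  asserts d (size d).-1 (Form t) -> sound_for_O phi d -> attack_rule t s ->
  entails (opponent_asserted (rcons d (Move s (Attack (size d).-1))))
          (attack_goal t s).
Proof.
move=> Hd od Ht Bd ts; set m := Move _ _.
have sd : (size d).-1.+1 = size d by case: (size d) od.
have Hd' : finite_S_dialogue E' phi (rcons d m).
  apply: opponent_reply_permitted => //; last by left.
  split; first by rewrite sd.
  split; first by rewrite /opponents -{2}sd /=; case: odd.
  by exists t; split=> //; apply: asserts_rcons.
apply: (Bd _ Hd'); exists (size d), (size d).-1; split=> //.
- exact: onth_rcons_size.
- exact: asserts_rcons.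
- rewrite size_rcons; split=> //; split.
    by exists (size d).-1, s; apply: onth_rcons_size.
  move=> l; rewrite ltnS leqNgt => /negP lt_ld /(defends_lt _ _ _ _ Hd'.1) //.
- by move=> k _ []; rewrite size_rcons ltnS.
Qed.

Lemma assertion_sound phi d t :
  finite_S_dialogue E' phi d -> odd (size d) ->
  asserts d (size d).-1 (Form t) -> sound_for_O phi d ->
  entails (opponent_asserted d) t.
Proof.
move=> Hd od Ht Bd.
have sd : (size d).-1.+1 = size d by case: (size d) od.
have att s := reply_attack_sound phi d t s Hd od Ht Bd.
(* A symbolic attack adds no hypothesis; an attack by a formula adds at most that formula. *)
have symbolic s r a :
    opponent_asserted (rcons d (Move (Sym s) r)) a -> opponent_asserted d a.
  by case/opponent_asserted_rcons_O.
have formal c r a : opponent_asserted (rcons d (Move (Form c) r)) a ->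
    add_hyp (opponent_asserted d) c a.
  by case/opponent_asserted_rcons_O => [|[->]]; [left | right].
case: t Ht att => [p|a|a b|a b|a b] Ht att.
- have Pn : by_P (size d).-1 by move: od; rewrite -{1}sd /by_P /=.
  case: (Hd.2.1 _ _ Pn Ht) => k [_ [Ok [Hk|Hk]]].
    by apply: Ent_hyp; exists k.
  by apply: (Ent_MP _ (Neg (Neg (Atom p)))); [apply/Ent_ax/SL_stable | apply: Ent_hyp; exists k].
- have /= := att _ (Attack_Neg a).
  by move/(entails_weaken _ _ _ (formal a _))/entails_NegI.
- have /= := att _ (Attack_Or a b).
  exact: entails_weaken (symbolic Query _).
- have /= Ha := entails_weaken _ _ _ (symbolic AndL _) (att _ (Attack_AndL a b)).
  have /= Hb := entails_weaken _ _ _ (symbolic AndR _) (att _ (Attack_AndR a b)).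
  by apply: Ent_MP Hb; apply: Ent_MP Ha; apply/entails_IL/IL_AndI.
- have /= := att _ (Attack_Imp a b).
  by move/(entails_weaken _ _ _ (formal a _))/entails_deduction.
Qed.

(** Proponent's attack followed by Opponent's defense leaves Opponent's open attacks unchanged, so
    the goal stays the same and only the hypothesis [c] is gained. *)
Lemma reply_defense_sound phi d i g u c f s :
  finite_S_dialogue E' phi (rcons d (Move u (Attack i))) -> ~~ odd (size d) ->
  asserts d i (Form g) -> i < size d ->
  sound_for_O phi (rcons d (Move u (Attack i))) -> defense_rule g u (Form c) ->
  latest_open_attack d f s ->
  entails (add_hyp (opponent_asserted d) c) (attack_goal f s).
Proof.
set m := Move u _ => Hd ed Hg lt_id Bd def [j [k [Oj Hj Hf op latest]]].
pose m' := Move (Form c) (Defense (size d)).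
have Hd' : finite_S_dialogue E' phi (rcons (rcons d m) m').
  apply: opponent_reply_permitted; rewrite ?size_rcons //=; last by right.
  split; first exact: ltnSn.
  split; first by rewrite /opponents /= (negPf ed).
  exists i, g, u; split; first exact/onth_rcons_old/onth_rcons_size.
  by split=> //; do 2!apply: asserts_rcons.
(* Of the two new moves, the first belongs to Proponent and the second is a defense, so neither is
   an attack by Opponent. *)
have old l : by_O l -> open_attack (rcons (rcons d m) m') (size d).+2 l ->
    open_attack d (size d) l.
  move=> Ol [lt_l [[x Hx] nd]].
  have lt_ld : l < size d.
    move: lt_l; rewrite ltnS leq_eqVlt ltnS leq_eqVlt => /or3P [/eqP El|/eqP El|//].
      by case/attacks_rcons_inv: Hx => [[y /onth_lt]|[_]] //=; rewrite El size_rcons ltnn.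
    by move: Ol; rewrite El /by_O (negPf ed).
  split=> //; split.
    exists x; case/attacks_rcons_inv: Hx => [/attacks_rcons_inv []|[_]] // [El _].
    by move: lt_ld; rewrite El ltnn.
  move=> y lt_y [z Hz]; apply: (nd y); first by do 2!apply: ltnW.
  by exists z; do 2!apply: onth_rcons_old.
have Hs : latest_open_attack (rcons (rcons d m) m') f s.
  exists j, k; split=> //; try by do 2!(apply: onth_rcons_old || apply: asserts_rcons).
    (* The attack [j] stays open: the first new move is an attack, and the second answers move
       [size d], which is not [j]. *)
    case: op => lt_jd [_ nd]; rewrite !size_rcons; split; first by do 2!apply: ltnW.
    split; first by exists k, s; do 2!apply: onth_rcons_old.
    move=> l _ /defends_rcons_inv [/defends_rcons_inv [Hl|[_]]|[_ [Ej]]] //.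
      by case: (Hl) => z /onth_lt lt_l; apply: (nd l).
    by move: lt_jd; rewrite Ej ltnn.
  by move=> l Ol; rewrite !size_rcons => /(old _ Ol); apply: latest.
apply: entails_weaken (Bd _ Hd' _ _ Hs) => a /opponent_asserted_rcons_O [|[->]].
  by move/(opponent_asserted_rcons_P _ _ _ ed); left.
by right.
Qed.

(** An attack eliminates a formula asserted by Opponent, each possible defense giving one premise; a
    defense asserts a formula that yields the goal of the attack it answers. *)
Lemma sound_for_P_of_move phi d m :
  0 < size d -> ~~ odd (size d) -> finite_S_dialogue E' phi (rcons d m) ->
  sound_for_O phi (rcons d m) -> sound_for_P d.
Proof.
move=> d0 ed Hd Bd f s Hfs.
have asserted_sound c : asserted m = Form c -> entails (opponent_asserted d) c.
  move=> Em; apply: (entails_weaken _ _ _ (fun b => opponent_asserted_rcons_P d m b ed)).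
  apply: (assertion_sound phi) => //; rewrite size_rcons //=.
  by exists (role_of m); rewrite -Em onth_rcons_size; case: (m).
have mok : particle_ok (rcons d m) (size d) m.
  exact: (Hd.1.2 _ _ d0 (onth_rcons_size _ _ _)).
case: m Hd Bd asserted_sound mok => u [|i|j] Hd Bd asserted_sound; rewrite /particle_ok //=.
- move=> [lt_id [opp [g [[r Hg'] gu]]]].
  have Hg : asserts d i (Form g).
    exists r; case/onth_rcons_inv: Hg' => // -[Ei _].
    by move: lt_id; rewrite Ei ltnn.
  have Gg : entails (opponent_asserted d) g.
    apply: Ent_hyp; exists i; split=> //.
    by move: opp; rewrite /opponents (negPf ed) /by_O; case: odd.
  have reply c := fun def => reply_defense_sound _ _ _ _ _ c _ _ Hd ed Hg lt_id Bd def Hfs.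
  case: gu Gg reply asserted_sound => [a b|a b|a b|a b|a] Gg reply asserted_sound.
  + apply: entails_cut (reply _ (Defense_AndL a b)) _.
    by apply: Ent_MP Gg; apply/entails_IL/IL_AndEl.
  + apply: entails_cut (reply _ (Defense_AndR a b)) _.
    by apply: Ent_MP Gg; apply/entails_IL/IL_AndEr.
  + exact: entails_OrE Gg (reply _ (Defense_OrL a b)) (reply _ (Defense_OrR a b)).
  (* The attacking formula [a] is itself entailed, since Opponent may attack it instead of
     defending. *)
  + apply: entails_cut (reply _ (Defense_Imp a b)) _.
    exact: Ent_MP Gg (asserted_sound a erefl).
  + exact: entails_explosion Gg (asserted_sound a erefl).
- move=> [lt_jd [opp [i [g [v [Hj' [[r Hg'] def]]]]]]].
  case: Hfs => k [l [Ok Hk [r' Hf] op latest]].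
  have [opj latestj] : open_attack d (size d) j /\
      forall k, opponents k (size d) -> open_attack d (size d) k -> k <= j.
    case: (Hd.2.2.1 (size d) j) => [|opj lj]; first by exists u; apply: onth_rcons_size.
    split; first exact: (proj1 (open_attack_rcons _ _ _ _ (leqnn _)) opj).
    by move=> x ox Hx; apply: lj => //; apply/open_attack_rcons.
  (* By D11 the attack answered is the latest open one, so its goal is the current goal. *)
  have Ej : j = k.
    apply/eqP; rewrite eqn_leq latest //=; last first.
      by move: opp; rewrite /opponents (negPf ed) /by_O; case: odd.
    by apply: latestj => //; rewrite /opponents (negPf ed) -[odd k]/(by_O k) Ok.
  move: Hj'; rewrite Ej (onth_rcons_old _ _ _ _ _ Hk) => -[Ev Ei].
  move: Hg'; rewrite -Ei (onth_rcons_old _ _ _ _ _ Hf) => -[Eg _].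
  rewrite -Ev -Eg in def.
  have [c Ec] := defense_goal _ _ _ def; apply.
  exact: asserted_sound.
Qed.

(** * Infinite plays *)

(** Dependent choice by means of [epsilon]: the chosen sequences extend one another, and [f]
    collects their last entries. *)
Lemma infinite_prolongation (T : Type) (Q : seq T -> Prop) (x : T) :
  Q [:: x] -> (forall d, Q d -> exists m, Q (rcons d m)) ->
  exists f : nat -> T, forall n, Q (mkseq f n.+1).
Proof.
move=> Q1 QS.
pose g d := epsilon (inhabits x) (fun m => Q (rcons d m)).
pose fix pos n := if n is n'.+1 then rcons (pos n') (g (pos n')) else [:: x].
pose f n := last x (pos n).
exists f => n; suff -> : mkseq f n.+1 = pos n.
  elim: n => //= n /QS; exact: epsilon_spec.
by elim: n => // n IHn; rewrite mkseqS IHn /= /f /= last_rcons.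
Qed.

Lemma finite_follows_rcons sigma d m :
  (~~ odd (size d) -> m = sigma d) -> finite_follows sigma d ->
  finite_follows sigma (rcons d m).
Proof.
move=> Em fd n x n0 Pn /onth_rcons_inv [Hn|[En <-]].
  have lt_nd := onth_lt Hn.
  rewrite -cats1 takel_cat; last exact: ltnW.
  exact: fd.
by rewrite En -cats1 take_size_cat //; apply: Em; rewrite -En.
Qed.

(** The next move has number [size d], so Opponent is to move exactly when this is odd. *)
Definition sound (phi : formula) (d : seq move) : Prop :=
  if odd (size d) then sound_for_O phi d else sound_for_P d.

Lemma unsound_prolongation phi sigma d : winning_strategy E' phi sigma ->
  0 < size d -> finite_S_dialogue E' phi d -> finite_follows sigma d ->
  ~ sound phi d ->
  exists m, [/\ finite_S_dialogue E' phi (rcons d m),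
    finite_follows sigma (rcons d m) & ~ sound phi (rcons d m)].
Proof.
move=> [_ win] d0 Hd fd; rewrite /sound; case: ifPn => od.
  move=> nB; have [m nBm] := not_all_ex_not _ _ nB.
  have [Hm Sm] := imply_to_and _ _ nBm.
  (* The prescription does not constrain Opponent, so the bad reply is consistent with it. *)
  exists m; split=> //; last by rewrite size_rcons /= od.
  by apply: finite_follows_rcons => //; rewrite od.
(* Otherwise the play would be maximal, hence won with a last move by Proponent, but Opponent moved
   last. *)
move=> Sd; have [m [Hm fm]] : exists m,
    finite_S_dialogue E' phi (rcons d m) /\ finite_follows sigma (rcons d m).
  apply: NNPP => /(win (Defs.Finite d) Hd fd) [Pd _].
  by move: od Pd; rewrite /by_P; case: (size d) d0 => //= n _ /negPn ->.
exists m; split=> //; rewrite size_rcons /= od => Bm.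
by apply/Sd/(sound_for_P_of_move phi d m).
Qed.

Theorem theorem7 (phi : formula) : dialogue_logic E' phi -> stable_logic phi.
Proof.
move=> [sigma win]; have H0 := win.1.
apply: NNPP => nphi.
(* Opponent has asserted nothing yet, so a sound opening would give [phi] without hypotheses. *)
have unsound0 : ~ sound phi [:: opening phi].
  move=> B0; apply: nphi; apply: (entails_stable_logic (opponent_asserted [:: opening phi])).
    by move=> a [k [Ok [r /onth1P [Ek _]]]]; move: Ok; rewrite Ek.
  by apply: (assertion_sound phi) => //; exists Opening.
pose Q d := [/\ 0 < size d, finite_S_dialogue E' phi d,
                finite_follows sigma d & ~ sound phi d].
have [||f Qf] := infinite_prolongation _ Q (opening phi).
- by split=> // n m n0 _ /onth1P [En _]; move: n0; rewrite En.
- move=> d [d0 Hd fd Sd].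
  have [m [Hm fm Sm]] := unsound_prolongation _ _ _ win d0 Hd fd Sd.
  by exists m; split=> //; rewrite size_rcons.
by apply: (win.2 (Defs.Infinite f)) => // n; case: (Qf n).
Qed.
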